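(* Let $G_j=(V_j,E_j)$, $j=1,2$, be two regular bipartite graphs of vertex degrees $d_j$, respectively, satisfying $$\nu(G_j)=d_j-\sqrt{d_j}.$$ Then the Cartesian product $G=G_1\times G_2$ is also a $d$-regular bipartite graph with $d=d_1+d_2$ and $$\nu(G)=d-\sqrt d.$$
   Context: All graphs $G=(V,E)$ are finite and simple; $x\sim y$ denotes adjacency. $E^{or}(G)$ is the set of ordered pairs $(x,y)$ with $x\sim y$. A magnetic potential is a map $\sigma:E^{or}(G)\to S^1=\{z\in\mathbb{C}:|z|=1\}$ with $\sigma(y,x)=\sigma(x,y)^{-1}$. The magnetic Laplacian on functions $f:V\to\mathbb{C}$ is $\Delta^\sigma f(x)=\sum_{y\sim x}(f(x)-\sigma(x,y)f(y))$, and $\lambda_1^\sigma(G)$ is its smallest eigenvalue. The magneto-spectral height is $\nu(G)=\sup_\sigma\lambda_1^\sigma(G)$, over all magnetic potentials. The Cartesian product $G_1\times G_2$ has vertex set $V_1\times V_2$, with $(x_1,y_1)\sim(x_2,y_2)$ if and only if either $x_1\sim x_2$ and $y_1=y_2$, or $x_1=x_2$ and $y_1\sim y_2$. *)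

(* Defs.v *)
From HB Require Import structures.
From mathcomp Require Import all_boot all_order all_algebra.
From mathcomp Require Import complex.
From mathcomp Require Import boolp classical_sets reals.

Set Implicit Arguments.
Unset Strict Implicit.
Unset Printing Implicit Defensive.

Import Order.TTheory GRing.Theory Num.Theory passmx.
Local Open Scope complex_scope.
Local Open Scope ring_scope.

Record sgraph := SGraph {
  vertex :> finType;
  adj : rel vertex;
  adj_sym : symmetric adj;
  adj_irrefl : irreflexive adj }.

Definition regular (G : sgraph) (d : nat) : Prop :=
  forall x : G, #|[set y | adj x y]| = d.

Definition bipartite (G : sgraph) : Prop :=
  exists A : {set G}, forall x y : G, adj x y -> (x \in A) != (y \in A).

Section CartesianProduct.
Variables G1 G2 : sgraph.

Definition cart_adj : rel (G1 * G2)%type := fun p q =>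
  (adj p.1 q.1 && (p.2 == q.2)) || ((p.1 == q.1) && adj p.2 q.2).

Lemma cart_adj_sym : symmetric cart_adj.
Proof.
move=> p q; rewrite /cart_adj (adj_sym p.1) (adj_sym p.2).
by rewrite (eq_sym p.1) (eq_sym p.2).
Qed.

Lemma cart_adj_irrefl : irreflexive cart_adj.
Proof. by move=> p; rewrite /cart_adj !adj_irrefl andbF. Qed.

Definition cart_prod : sgraph := SGraph cart_adj_sym cart_adj_irrefl.
End CartesianProduct.

Section Magnetic.
Variables (R : realType) (G : sgraph).

(* A potential lives on ordered adjacent pairs; it is encoded by a total
   function whose values off the edges are unconstrained and never used. *)
Definition magnetic_potential (s : G -> G -> R[i]) : Prop :=
  forall x y : G, adj x y -> `|s x y| = 1 /\ s y x = (s x y)^-1.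

(* R[i]^o is R[i] seen as a vector space over itself. *)
Definition magnetic_laplacian (s : G -> G -> R[i])
    (f : {ffun G -> R[i]^o}) : {ffun G -> R[i]^o} :=
  [ffun x => \sum_(y : G | adj x y) (f x - s x y * f y)].

Lemma magnetic_laplacian_is_linear s : linear (magnetic_laplacian s).
Proof.
move=> a f g; apply/ffunP=> x; rewrite !ffunE scaler_sumr -big_split /=.
apply: eq_bigr => y _; rewrite !ffunE /GRing.scale /=.
by rewrite mulrBr mulrDr opprD addrACA mulrCA.
Qed.

HB.instance Definition _ s := GRing.isLinear.Build R[i] {ffun G -> R[i]^o}
  {ffun G -> R[i]^o} *:%R (magnetic_laplacian s) (magnetic_laplacian_is_linear s).

Definition laplacian_eigenvalue (s : G -> G -> R[i]) (a : R[i]) : bool :=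
  leigenvalue (linfun (magnetic_laplacian s)) a.

(* When G has a vertex, all eigenvalues are real, this infimum is a minimum
   and the supremum below is over a bounded nonempty set: see
   laplacian_eigenvalue_real, lambda1_min and nu_has_sup. *)
Definition lambda1 (s : G -> G -> R[i]) : R :=
  inf [set l : R | laplacian_eigenvalue s l%:C]%classic.

Definition nu : R :=
  sup [set lambda1 s | s in [set s | magnetic_potential s]]%classic.

Lemma laplacian_eigenvalueP s a :
  reflect (exists2 f, f != 0 & magnetic_laplacian s f = a *: f)
          (laplacian_eigenvalue s a).
Proof.
have E f : (f \in leigenspace (linfun (magnetic_laplacian s)) a)
           = (magnetic_laplacian s f == a *: f).
  by rewrite memv_ker add_lfunE opp_lfunE scale_lfunE id_lfunE lfunE subr_eq0.
apply: (iffP idP) => [ev | [f f0 fE]].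
  exists (vpick (leigenspace (linfun (magnetic_laplacian s)) a)).
    by rewrite vpick0.
  by apply/eqP; rewrite -E memv_pick.
rewrite /laplacian_eigenvalue /leigenvalue; apply: contra f0 => /eqP E0.
by rewrite -memv0 -E0 E fE.
Qed.

Lemma laplacian_eigenvalue_real s a : magnetic_potential s ->
  laplacian_eigenvalue s a -> a \is Num.real.
Proof.
move=> sP /laplacian_eigenvalueP[f f0 fE].
pose N : R[i] := \sum_x f x * (f x)^*.
have N0 : 0 < N.
  have [x fx0] : exists x, f x != 0.
    apply/existsP; apply: contraR f0 => /existsPn fx; apply/eqP/ffunP=> x.
    by rewrite ffunE; move: (fx x); rewrite negbK => /eqP.
  rewrite /N (bigD1 x) //= ltr_pwDl ?sumr_ge0 // => [|y _].
    by rewrite -normCK exprn_gt0 ?normr_gt0.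
  by rewrite -normCK exprn_ge0.
pose q : R[i] := \sum_x magnetic_laplacian s f x * (f x)^*.
have qE : q = a * N.
  by rewrite /q /N mulr_sumr; apply: eq_bigr => x _; rewrite fE ffunE -mulrA.
have qr : q^* = q.
  have -> : q = \sum_x \sum_(y | adj x y) f x * (f x)^*
               - \sum_x \sum_(y | adj x y) s x y * f y * (f x)^*.
    rewrite /q -sumrB; apply: eq_bigr => x _.
    rewrite ffunE mulr_suml -sumrB; apply: eq_bigr => y _.
    by rewrite mulrBl.
  rewrite rmorphB !rmorph_sum; congr (_ - _).
    apply: eq_bigr => x _; rewrite rmorph_sum; apply: eq_bigr => y _.
    by rewrite rmorphM /= conjCK mulrC.
  under eq_bigr => x _ do rewrite rmorph_sum.
  rewrite (exchange_big_dep predT) //=; apply: eq_bigr => x _.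
  apply: eq_big => y; first by rewrite adj_sym.
  move=> xy; rewrite !rmorphM /= conjCK; have [n1 ->] := sP _ _ xy.
  by rewrite invC_norm n1 expr1n invr1 mul1r -!mulrA (mulrC (f y)).
apply/CrealP; apply: (mulIf (lt0r_neq0 N0)).
have Nr : N^* = N by apply/CrealP/gtr0_real.
by rewrite -[in LHS]Nr -rmorphM -qE.
Qed.

Lemma lambda1_min s : (0 < #|G|)%N -> magnetic_potential s ->
  laplacian_eigenvalue s (lambda1 s)%:C /\
  forall a, laplacian_eigenvalue s a -> (lambda1 s)%:C <= a.
Proof.
move=> G0 sP.
pose e := vbasis {:{ffun G -> R[i]^o}}.
have eB : basis_of {:{ffun G -> R[i]^o}} e := vbasisP _.
pose A := mxof e e (linfun (magnetic_laplacian s)).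
have evE a : laplacian_eigenvalue s a = root (char_poly A) a.
  rewrite /laplacian_eigenvalue /leigenvalue (leigenspaceE eB).
  by rewrite (vsof_eq0 eB) -eigenvalue_root_char.
have [rs rsE] := closed_field_poly_normal (char_poly A).
rewrite (monicP (char_poly_monic A)) scale1r in rsE.
have {}evE a : laplacian_eigenvalue s a = (a \in rs).
  by rewrite evE rsE root_prod_XsubC.
have rs0 : (0 < size rs)%N.
  have : size (char_poly A) = (size rs).+1 by rewrite rsE size_prod_XsubC.
  by rewrite size_char_poly dimvf /dim /= muln1 => -[<-].
have reE a : a \in rs -> (complex.Re a)%:C = a.
  by rewrite -evE => /(laplacian_eigenvalue_real sP)/RRe_real.
pose F (i : 'I_(size rs)) := complex.Re (tnth (in_tuple rs) i).
have [i _ iP] := @arg_minP _ R _ (Ordinal rs0) predT F isT.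
have Fi : (F i)%:C \in rs by rewrite /F reE ?mem_tnth.
have Fmin a : a \in rs -> (F i)%:C <= a.
  move=> ars; rewrite -(reE _ ars) lecR.
  have /tnthP[j ->] : a \in in_tuple rs by [].
  exact: iP.
have lbF : lbound [set l : R | laplacian_eigenvalue s l%:C]%classic (F i).
  by move=> l /=; rewrite evE => /Fmin; rewrite lecR.
suff -> : lambda1 s = F i.
  by rewrite evE; split=> // a; rewrite evE; exact: Fmin.
apply/eqP; rewrite eq_le; apply/andP; split.
  by apply: ge_inf => /=; [exists (F i) | rewrite evE].
by apply: lb_le_inf => //; exists (F i); rewrite /= evE.
Qed.

Lemma laplacian_eigenvalue_bound s a : magnetic_potential s ->
  laplacian_eigenvalue s a -> `|a| <= (#|G| * 2)%:R.
Proof.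
move=> sP /laplacian_eigenvalueP[f f0 fE].
have [x0 fx0] : exists x, f x != 0.
  apply/existsP; apply: contraR f0 => /existsPn fx; apply/eqP/ffunP=> x.
  by rewrite ffunE; move: (fx x); rewrite negbK => /eqP.
pose F x := complex.Re `|f x|.
have FE x : (F x)%:C = `|f x| by rewrite /F RRe_real ?normr_real.
have [x _ xmax] := @arg_maxP _ R _ x0 predT F isT.
have {}xmax y : `|f y| <= `|f x| by rewrite -!FE lecR; exact: xmax.
have fx0' : 0 < `|f x| by rewrite (lt_le_trans _ (xmax x0)) ?normr_gt0.
rewrite -(ler_pM2r fx0') -normrM.
have -> : a * f x = magnetic_laplacian s f x by rewrite fE ffunE.
rewrite ffunE (le_trans (ler_norm_sum _ _ _)) //.
apply: (@le_trans _ _ (\sum_(y | adj x y) `|f x| *+ 2)).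
  apply: ler_sum => y xy; rewrite (le_trans (ler_normB _ _)) // mulr2n lerD2l.
  by rewrite normrM (sP _ _ xy).1 mul1r.
rewrite sumr_const -mulrnA mulr_natl ler_wpMn2l //.
by rewrite mulnC leq_mul2r max_card.
Qed.

Lemma nu_has_sup : (0 < #|G|)%N ->
  has_sup [set lambda1 s | s in [set s | magnetic_potential s]]%classic.
Proof.
move=> G0; split.
  exists (lambda1 (fun _ _ => 1)), (fun _ _ => 1) => //= x y _.
  by rewrite normr1 invr1.
exists (#|G| * 2)%:R => _ [s sP <-].
have [/(laplacian_eigenvalue_bound sP) h _] := lambda1_min G0 sP.
have l_real : (lambda1 s)%:C \is Num.real by apply/complex_realP; exists (lambda1 s).
have := le_trans (real_ler_norm l_real) h.
by rewrite -(rmorph_nat (real_complex R)) lecR.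
Qed.
End Magnetic.

(* Main.v *)
Require Import Defs.
From mathcomp Require Import all_boot all_order all_algebra.
From mathcomp Require Import complex.
From mathcomp Require Import boolp classical_sets reals.
From mathcomp Require Import lra.
Set Implicit Arguments.
Unset Strict Implicit.
Unset Printing Implicit Defensive.
Import Order.TTheory GRing.Theory Num.Theory.
Local Open Scope ring_scope.

(** Write A for the magnetic adjacency operator, so that the Laplacian of a
d-regular graph is d - A and d - lambda1 is the largest eigenvalue of A.

On a bipartite graph, multiplication by the sign function eps of the
bipartition anticommutes with A, so the spectrum of A is symmetric and
m = d - lambda1 is its spectral radius; as A is Hermitian, |A f| <= m |f| for
all f ([adj_op_bound]).  Testing this on the indicator of a vertex x, whose
image has squared norm d because x has d neighbours and the potential is
unimodular, gives d <= m^2.  Hence nu <= d - sqrt d for every nonempty d-regular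
bipartite graph ([nu_le]), in particular for the product.

For the reverse inequality, potentials s1 and s2 on the factors are combined
by using s1 along the edges of G1 and eps s2 along the edges of G2, where eps
is the sign function of a bipartition of G1 ([cart_potential]).  The
adjacency operator of the product is then A1 + eps A2.  Since A1 and eps
anticommute while A2 commutes with both, the mixed terms of its square
cancel: A^2 = A1^2 + A2^2 ([cart_adj_op_sq]).  Consequently
m^2 <= m1^2 + m2^2 ([lambda1_cart_potential]).  The
hypothesis on nu only gives potentials with m1 and m2 arbitrarily close to
sqrt d1 and sqrt d2, which is enough: m is then arbitrarily close to at most
sqrt (d1 + d2), and no optimal potential has to be exhibited. *)

(** * Hermitian kernels on a finite set *)

Section Kernel.
Variables (C : numClosedFieldType) (T : finType).

Definition kernel_op (k : T -> T -> C) (f : T -> C) (x : T) : C :=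
  \sum_y k x y * f y.

Definition normsq (f : T -> C) : C := \sum_x `|f x| ^+ 2.

Definition hermitian_kernel (k : T -> T -> C) := forall x y, k y x = (k x y)^*.

Lemma kernel_opD (k : T -> T -> C) f g x :
  kernel_op k (fun y => f y + g y) x = kernel_op k f x + kernel_op k g x.
Proof. by rewrite -big_split; apply: eq_bigr => y _; rewrite mulrDr. Qed.

Lemma kernel_opZ (k : T -> T -> C) c f x :
  kernel_op k (fun y => c * f y) x = c * kernel_op k f x.
Proof. by rewrite mulr_sumr; apply: eq_bigr => y _; rewrite mulrCA. Qed.

Lemma normsq_gt0 (f : T -> C) x : f x != 0 -> 0 < normsq f.
Proof.
move=> fx0; rewrite /normsq (bigD1 x) //= ltr_pwDl ?exprn_gt0 ?normr_gt0 //.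
by rewrite sumr_ge0 // => y _; rewrite exprn_ge0.
Qed.

(** The norm of a Hermitian operator is its spectral radius.  The kernel is
turned into a matrix, which the spectral theorem diagonalizes in a unitary
basis; there each coordinate is multiplied by an eigenvalue, and unitary maps
preserve the norm. *)
Lemma hermitian_kernel_bound (k : T -> T -> C) (m : C) : hermitian_kernel k ->
  (forall a f x, f x != 0 -> (forall y, kernel_op k f y = a * f y) ->
     `|a| <= m) ->
  forall f, normsq (kernel_op k f) <= m ^+ 2 * normsq f.
Proof.
move=> kH evk f.
(* The transposed kernel, because matrices act on row vectors. *)
pose H : 'M[C]_#|T| := \matrix_(i, j) k (enum_val j) (enum_val i).
have Hrow (v : 'rV_#|T|) x :
    (v *m H) 0 (enum_rank x) = kernel_op k (fun y => v 0 (enum_rank y)) x.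
  rewrite mxE /kernel_op (reindex (@enum_rank T)) /=; last first.
    by apply: onW_bij; exact: enum_rank_bij.
  by apply: eq_bigr => y _; rewrite mxE !enum_rankK mulrC.
have Hnormal : H \is normalmx.
  apply: hermitian_normalmx; apply/is_hermitianmxP; rewrite expr0 scale1r.
  by apply/matrixP=> i j; rewrite !mxE -kH.
pose P := spectralmx H; pose sp := spectral_diag H.
have Pu : P \is unitarymx := spectral_unitarymx H.
have HE : H = invmx P *m diag_mx sp *m P by apply/orthomx_spectralP.
have PV : P *m invmx P = 1%:M by rewrite mulmxV ?unitarymx_unit.
have spm i : `|sp 0 i| <= m.
  have Pi0 : row i P != 0.
    apply/eqP=> Pi0; have /rowP/(_ i)/eqP : row i (P *m invmx P) = 0.
      by rewrite row_mul Pi0 mul0mx.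
    by rewrite PV !mxE eqxx oner_eq0.
  have [j Pij] : exists j, row i P 0 j != 0.
    apply/existsP; apply: contraR Pi0 => /existsPn Pi0; apply/eqP/rowP=> j.
    by move: (Pi0 j); rewrite negbK => /eqP ->; rewrite mxE.
  apply: (evk _ (fun y => row i P 0 (enum_rank y)) (enum_val j)).
    by rewrite enum_valK.
  move=> y; rewrite -Hrow -row_mul HE !mulmxA PV mul1mx row_mul.
  by rewrite row_diag_mx -scalemxAl -rowE !mxE.
pose nv (v : 'rV[C]_#|T|) : C := (v *m (map_mx Num.conj v^T)) 0 0.
have nvE v : nv v = \sum_i `|v 0 i| ^+ 2.
  by rewrite /nv mxE; apply: eq_bigr => i _; rewrite !mxE normCK.
have nvU v : nv (v *m P) = nv v.
  by rewrite /nv trmx_mul map_mxM mulmxA -(mulmxA v) (unitarymxP Pu) mulmx1.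
have nvT v : nv v = normsq (fun y => v 0 (enum_rank y)).
  rewrite nvE /normsq (reindex (@enum_rank T)) //=.
  by apply: onW_bij; exact: enum_rank_bij.
pose v : 'rV[C]_#|T| := \row_i f (enum_val i).
have vE : normsq f = nv v.
  by rewrite nvT; apply: eq_bigr => x _; rewrite mxE enum_rankK.
have HvE : normsq (kernel_op k f) = nv (v *m H).
  rewrite nvT; apply: eq_bigr => x _; rewrite Hrow /kernel_op.
  by congr (`|_| ^+ 2); apply: eq_bigr => y _; rewrite mxE enum_rankK.
rewrite HvE vE; have -> : v = v *m invmx P *m P.
  by rewrite -mulmxA mulVmx ?mulmx1 ?unitarymx_unit.
set w := v *m invmx P.
rewrite HE !mulmxA -(mulmxA w) PV mulmx1 !nvU !nvE mulr_sumr.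
apply: ler_sum => i _; rewrite mul_mx_diag mxE normrM exprMn mulrC.
apply: ler_wpM2r; rewrite ?exprn_ge0 //.
by rewrite lerXn2r ?nnegrE ?(le_trans _ (spm i)).
Qed.

Lemma kernel_op_sym (k : T -> T -> C) : hermitian_kernel k -> forall f g,
  \sum_x kernel_op k f x * (g x)^* = \sum_x f x * (kernel_op k g x)^*.
Proof.
move=> kH f g; rewrite /kernel_op.
under eq_bigr do rewrite mulr_suml.
rewrite exchange_big; apply: eq_bigr => x _ /=.
rewrite rmorph_sum mulr_sumr; apply: eq_bigr => y _.
by rewrite rmorphM /= -kH mulrCA mulrA.
Qed.

Lemma normsq_kernel_op (k : T -> T -> C) : hermitian_kernel k -> forall f,
  normsq (kernel_op k f) = \sum_x kernel_op k (kernel_op k f) x * (f x)^*.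
Proof.
move=> kH f; rewrite kernel_op_sym //.
by apply: eq_bigr => x _; rewrite normCK.
Qed.

End Kernel.

Lemma kernel_op_comm (C : numClosedFieldType) (T1 T2 : finType)
    (k1 : T1 -> T1 -> C) (k2 : T2 -> T2 -> C) (f : T1 -> T2 -> C) x y :
  kernel_op k1 (fun x' => kernel_op k2 (f x') y) x =
  kernel_op k2 (fun y' => kernel_op k1 (fun x' => f x' y') x) y.
Proof.
rewrite /kernel_op; under eq_bigr do rewrite mulr_sumr.
rewrite exchange_big; apply: eq_bigr => y' _; rewrite mulr_sumr.
by apply: eq_bigr => x' _; rewrite mulrCA.
Qed.

(** * The magnetic adjacency operator *)

Section MagneticAdjacency.
Variables (R : realType) (G : sgraph).
Implicit Types (s : G -> G -> R[i]) (f : G -> R[i]).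

Definition adj_kernel s x y : R[i] := if adj x y then s x y else 0.

Lemma adj_opE s f x :
  kernel_op (adj_kernel s) f x = \sum_(y | adj x y) s x y * f y.
Proof.
rewrite [RHS]big_mkcond; apply: eq_bigr => y _.
by rewrite /adj_kernel; case: ifP => //; rewrite mul0r.
Qed.

Lemma adj_kernel_hermitian s :
  magnetic_potential s -> hermitian_kernel (adj_kernel s).
Proof.
move=> sP x y; rewrite /adj_kernel adj_sym.
case: ifP => [xy|]; last by rewrite conjC0.
by have [n1 ->] := sP _ _ xy; rewrite invC_norm n1 expr1n invr1 mul1r.
Qed.

(** The Laplacian of a d-regular graph is d minus the adjacency operator. *)
Lemma laplacian_eigenvalue_adj s d (a : R[i]) : regular G d ->
  laplacian_eigenvalue s (d%:R - a) <->
  exists f, (exists x, f x != 0) /\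
    forall x, kernel_op (adj_kernel s) f x = a * f x.
Proof.
move=> Gd.
have lapE (f : {ffun G -> R[i]^o}) x : magnetic_laplacian s f x
    = d%:R * f x - kernel_op (adj_kernel s) f x.
  by rewrite ffunE sumrB adj_opE sumr_const -(Gd x) cardsE [RHS]/= mulr_natl.
split=> [/laplacian_eigenvalueP[f f0 fE]|[f [[x fx0] fE]]].
  exists f; split.
    apply/existsP; apply: contraR f0 => /existsPn fx; apply/eqP/ffunP=> x.
    by rewrite ffunE; move: (fx x); rewrite negbK => /eqP.
  move=> x; have := lapE f x; rewrite fE ffunE /GRing.scale /= mulrBl.
  by move=> /addrI/oppr_inj.
apply/laplacian_eigenvalueP; exists [ffun x => f x].
  by apply: contraNneq fx0 => /ffunP/(_ x); rewrite !ffunE => ->.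
apply/ffunP=> y; rewrite lapE !ffunE /GRing.scale /= mulrBl -fE.
by congr (_ - _); apply: eq_bigr => z _; rewrite ffunE.
Qed.

Definition bip_sign (A : {set G}) (x : G) : R[i] := (-1) ^+ (x \in A).

Definition bipartition (A : {set G}) :=
  forall x y : G, adj x y -> (x \in A) != (y \in A).

Lemma bip_sign_adj A : bipartition A -> forall x y, adj x y ->
  bip_sign A y = - bip_sign A x.
Proof.
move=> AP x y /AP; rewrite /bip_sign.
by case: (x \in A); case: (y \in A) => //= _; rewrite ?expr0 ?expr1 ?opprK.
Qed.

(** The adjacency operator moves mass across the bipartition, hence
anticommutes with the sign function.  Both the symmetry of its spectrum and
the cancellation in [cart_adj_op_sq] rest on this. *)
Lemma adj_op_sign A : bipartition A -> forall s f x,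
  kernel_op (adj_kernel s) (fun y => bip_sign A y * f y) x
  = - (bip_sign A x * kernel_op (adj_kernel s) f x).
Proof.
move=> AP s f x; rewrite !adj_opE mulr_sumr -sumrN; apply: eq_bigr => y xy.
by rewrite (bip_sign_adj AP xy) mulNr mulrN mulrCA.
Qed.

(** Multiplying an eigenfunction of the adjacency operator by the bipartition
sign negates its eigenvalue, so minimality of lambda1 bounds both a and
- a. *)
Lemma adj_eigenvalue_bound s d (a : R[i]) f x :
  regular G d -> bipartite G -> magnetic_potential s -> f x != 0 ->
  (forall y, kernel_op (adj_kernel s) f y = a * f y) ->
  `|a| <= (d%:R - lambda1 s)%:C%C.
Proof.
move=> Gd [A AP] sP fx0 fE.
have G0 : (0 < #|G|)%N by apply/card_gt0P; exists x.
have [_ lmin] := lambda1_min G0 sP.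
have ev b : (exists f, (exists x, f x != 0) /\
      forall x, kernel_op (adj_kernel s) f x = b * f x) ->
    b <= (d%:R - lambda1 s)%:C%C.
  move=> /(laplacian_eigenvalue_adj s b Gd)/lmin.
  by rewrite rmorphB /= rmorph_nat lerBrDl -lerBrDr.
have a1 : a <= (d%:R - lambda1 s)%:C%C.
  by apply: ev; exists f; split=> //; exists x.
have a2 : - a <= (d%:R - lambda1 s)%:C%C.
  apply: ev; exists (fun y => bip_sign A y * f y); split.
    by exists x; rewrite mulf_neq0 // /bip_sign signr_eq0.
  by move=> y; rewrite (adj_op_sign AP) fE mulNr mulrCA.
rewrite real_ler_norml; first by rewrite lerNl a2.
by rewrite (ler_real a1); apply/complex_realP; eexists.
Qed.

Lemma adj_top_eigenfunction s d : (0 < #|G|)%N ->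
  regular G d -> magnetic_potential s ->
  exists f, (exists x, f x != 0) /\
    forall x, kernel_op (adj_kernel s) f x = (d%:R - lambda1 s)%:C%C * f x.
Proof.
move=> G0 Gd sP; apply/(laplacian_eigenvalue_adj s _ Gd).
by rewrite rmorphB /= rmorph_nat subKr; have [] := lambda1_min G0 sP.
Qed.

Lemma adj_op_bound s d : regular G d -> bipartite G -> magnetic_potential s ->
  forall f, normsq (kernel_op (adj_kernel s) f)
    <= (d%:R - lambda1 s)%:C%C ^+ 2 * normsq f.
Proof.
move=> Gd Gb sP; apply: hermitian_kernel_bound.
  exact: adj_kernel_hermitian.
by move=> a f x fx0 fE; exact: (adj_eigenvalue_bound Gd Gb sP fx0 fE).
Qed.

(** The norm bound applied to the indicator of one vertex: its image has squared
norm d, so sqrt d is at most the spectral radius d - lambda1. *)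
Lemma lambda1_le s d : (0 < #|G|)%N -> regular G d -> bipartite G ->
  magnetic_potential s -> lambda1 s <= d%:R - Num.sqrt d%:R.
Proof.
move=> G0 Gd Gb sP; rewrite lerBrDr addrC -lerBrDr.
(* The largest eigenvalue itself obeys the bound on absolute values. *)
have m0 : 0 <= d%:R - lambda1 s.
  have [f [[x fx0] fE]] := adj_top_eigenfunction G0 Gd sP.
  by rewrite -ler0c (le_trans _ (adj_eigenvalue_bound Gd Gb sP fx0 fE)).
have /card_gt0P[x _] := G0.
have := adj_op_bound Gd Gb sP (fun y => (y == x)%:R).
have -> : normsq (fun y => (y == x)%:R) = 1 :> R[i].
  rewrite /normsq (bigD1 x) //= eqxx normr1 expr1n big1 ?addr0 // => y.
  by move=> /negPf ->; rewrite normr0 expr0n.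
have -> : normsq (kernel_op (adj_kernel s) (fun y => (y == x)%:R)) = d%:R.
  rewrite /normsq -(Gd x) cardsE -sum1_card natr_sum [RHS]big_mkcond.
  apply: eq_bigr => y _; rewrite /kernel_op (bigD1 x) //= eqxx mulr1 big1.
    rewrite addr0 /adj_kernel adj_sym -topredE /=; case: ifP => [xy|_].
      by have := xy; rewrite adj_sym => /sP[-> _]; rewrite expr1n.
    by rewrite normr0 expr0n.
  by move=> z /negPf ->; rewrite mulr0.
rewrite mulr1 -rmorphXn -(rmorph_nat (real_complex R)) lecR => dm.
by rewrite -(ger0_norm m0) -sqrtr_sqr ler_wsqrtr.
Qed.

Lemma nu_le d : (0 < #|G|)%N -> regular G d -> bipartite G ->
  nu R G <= d%:R - Num.sqrt d%:R.
Proof.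
move=> G0 Gd Gb; apply: ge_sup; first by case: (nu_has_sup R G0).
by move=> _ [s sP <-]; exact: lambda1_le.
Qed.

End MagneticAdjacency.

(** * Cartesian products *)

Section CartesianProduct.
Variables G1 G2 : sgraph.
Let G := cart_prod G1 G2.

Lemma sum_cart_adj (V : nmodType) (p : G) (F : G -> V) :
  \sum_(q | adj p q) F q = \sum_(x | adj p.1 x) F (x, p.2)
                         + \sum_(y | adj p.2 y) F (p.1, y).
Proof.
case: p => x y /=; rewrite (bigID (fun q : G => y == q.2)) /=.
congr (_ + _).
  rewrite (reindex_onto (fun x' => (x', y)) fst) /=; last first.
    by case=> x' y' /= /andP[_ /eqP <-].
  apply: eq_bigl => x'.
  by rewrite /cart_adj /= !eqxx adj_irrefl !andbT andbF orbF.
rewrite (reindex_onto (fun y' => (x, y')) snd) /=; last first.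
  case=> x' y' /= /andP[+ /negPf yy'].
  by rewrite /cart_adj /= yy' andbF => /andP[/eqP <-].
apply: eq_bigl => y'; rewrite /cart_adj /= !eqxx adj_irrefl /= andbT.
by case: eqVneq => [->|]; rewrite ?adj_irrefl ?andbT.
Qed.

Lemma cart_prod_regular d1 d2 : regular G1 d1 -> regular G2 d2 ->
  regular G (d1 + d2).
Proof.
move=> r1 r2 p; rewrite -(r1 p.1) -(r2 p.2) !cardsE -!sum1_card.
exact: (@sum_cart_adj nat p (fun=> 1%N)).
Qed.

(** Every edge of the product changes exactly one coordinate, so the parity of
the two sides is a bipartition. *)
Lemma cart_prod_bipartite : bipartite G1 -> bipartite G2 -> bipartite G.
Proof.
move=> [A AP] [B BP]; exists [set p : G | (p.1 \in A) (+) (p.2 \in B)].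
move=> [x y] [x' y']; rewrite !inE /= /cart_adj /=.
case/orP=> /andP[]; first by move=> /AP + /eqP <-; do 3! case: (_ \in _).
by move=> /eqP <- /BP; do 3! case: (_ \in _).
Qed.

Variable R : realType.

(** The edges of G2 are twisted by the bipartition sign of G1, which turns
the commuting operators of the two factors into anticommuting ones. *)
Definition cart_potential (A : {set G1}) (s1 : G1 -> G1 -> R[i])
    (s2 : G2 -> G2 -> R[i]) (p q : G) : R[i] :=
  if p.2 == q.2 then s1 p.1 q.1 else bip_sign R A p.1 * s2 p.2 q.2.

Lemma cart_potentialP A s1 s2 : magnetic_potential s1 ->
  magnetic_potential s2 -> magnetic_potential (cart_potential A s1 s2).
Proof.
move=> s1P s2P [x y] [x' y'] /=; rewrite /cart_adj /cart_potential /=.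
case/orP=> /andP[].
  by move=> /s1P[n1 ->] /eqP <-; rewrite eqxx.
move=> /eqP <- yy'.
have /negPf ne : y != y' by apply: contraTneq yy' => ->; rewrite adj_irrefl.
have [n2 ->] := s2P _ _ yy'.
rewrite (eq_sym y') ne normrM n2 mulr1 invfM /bip_sign.
by rewrite normrX normrN1 expr1n invr_sign.
Qed.

Lemma cart_adj_op A s1 s2 (f : G -> R[i]) x y :
  kernel_op (adj_kernel (cart_potential A s1 s2)) f (x, y) =
    kernel_op (adj_kernel s1) (fun x' => f (x', y)) x
  + bip_sign R A x * kernel_op (adj_kernel s2) (fun y' => f (x, y')) y.
Proof.
rewrite !adj_opE sum_cart_adj /= mulr_sumr; congr (_ + _).
  by apply: eq_bigr => x' _; rewrite /cart_potential eqxx.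
apply: eq_bigr => y' yy'; rewrite /cart_potential /=.
by case: eqVneq yy' => [->|]; rewrite ?adj_irrefl // mulrA.
Qed.

(** In (A1 + eps A2)^2 the mixed terms A1 eps A2 and eps A2 A1 are opposite,
since A1 anticommutes with eps and commutes with A2. *)
Lemma cart_adj_op_sq A s1 s2 (f : G -> R[i]) x y : bipartition A ->
  let K := kernel_op (adj_kernel (cart_potential A s1 s2)) in
  let K1 := kernel_op (adj_kernel s1) in
  let K2 := kernel_op (adj_kernel s2) in
  K (K f) (x, y) = K1 (K1 (fun x' => f (x', y))) x
                 + K2 (K2 (fun y' => f (x, y'))) y.
Proof.
move=> AP K K1 K2; rewrite /K cart_adj_op -/K.
have -> : (fun x' => K f (x', y)) = (fun x' => K1 (fun z => f (z, y)) x' +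
    bip_sign R A x' * K2 (fun z => f (x', z)) y).
  by apply/funext => x'; rewrite /K cart_adj_op.
have -> : (fun y' => K f (x, y')) = (fun y' => K1 (fun z => f (z, y')) x +
    bip_sign R A x * K2 (fun z => f (x, z)) y').
  by apply/funext => x'; rewrite /K cart_adj_op.
rewrite !kernel_opD kernel_opZ (adj_op_sign AP) mulrDr mulrA.
rewrite -expr2 /bip_sign sqrr_sign mul1r -addrA; congr (_ + _).
by rewrite -/K1 -/K2 /K1 /K2 kernel_op_comm addrA addNr add0r.
Qed.

(** With m = d - lambda1 for each graph, take f with A f = m f on the product.
Pairing A^2 f = A1^2 f + A2^2 f with f splits m^2 |f|^2 into the squared
norms of A1 on the slices of f along G1 and of A2 on the slices along G2,
and [adj_op_bound] applies to every slice. *)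
Lemma lambda1_cart_potential A s1 s2 d1 d2 :
  (0 < #|G1|)%N -> (0 < #|G2|)%N -> regular G1 d1 -> regular G2 d2 ->
  bipartition A -> bipartite G2 ->
  magnetic_potential s1 -> magnetic_potential s2 ->
  ((d1 + d2)%:R - lambda1 (cart_potential A s1 s2)) ^+ 2
    <= (d1%:R - lambda1 s1) ^+ 2 + (d2%:R - lambda1 s2) ^+ 2.
Proof.
move=> n1 n2 r1 r2 AP b2 s1P s2P.
have b1 : bipartite G1 by exists A.
have sP := cart_potentialP A s1P s2P.
have nG : (0 < #|G|)%N by rewrite card_prod muln_gt0 n1.
have [f [[p fp0] fE]] := adj_top_eigenfunction nG (cart_prod_regular r1 r2) sP.
have kH := adj_kernel_hermitian sP.
move: fE; set m := (_%:R - _); set m1 := (d1%:R - _); set m2 := (d2%:R - _).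
move=> fE.
have E : normsq (kernel_op (adj_kernel (cart_potential A s1 s2)) f)
    = (m ^+ 2)%:C%C * normsq f.
  rewrite /normsq mulr_sumr; apply: eq_bigr => q _.
  rewrite fE normrM exprMn real_normK ?rmorphXn //.
  by apply/complex_realP; eexists.
have fub (F : G1 -> G2 -> R[i]) : \sum_(q : G) F q.1 q.2 = \sum_x \sum_y F x y.
  by rewrite pair_bigA.
have normsq1 : normsq f = \sum_y normsq (fun x => f (x, y)).
  rewrite exchange_big -fub; apply: eq_bigr => q _.
  by rewrite -surjective_pairing.
have normsq2 : normsq f = \sum_x normsq (fun y => f (x, y)).
  by rewrite -fub; apply: eq_bigr => q _; rewrite -surjective_pairing.
have split_norm : normsq (kernel_op (adj_kernel (cart_potential A s1 s2)) f)
    = \sum_y normsq (kernel_op (adj_kernel s1) (fun x => f (x, y)))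
    + \sum_x normsq (kernel_op (adj_kernel s2) (fun y => f (x, y))).
  rewrite (normsq_kernel_op kH).
  under [X in _ = X + _]eq_bigr do
    rewrite (normsq_kernel_op (adj_kernel_hermitian s1P)).
  under [X in _ = _ + X]eq_bigr do
    rewrite (normsq_kernel_op (adj_kernel_hermitian s2P)).
  rewrite [X in _ = X + _]exchange_big -!fub -big_split.
  by apply: eq_bigr => -[x y] _; rewrite cart_adj_op_sq // mulrDl.
have : normsq (kernel_op (adj_kernel (cart_potential A s1 s2)) f)
    <= (m1 ^+ 2 + m2 ^+ 2)%:C%C * normsq f.
  rewrite split_norm rmorphD mulrDl [in X in _ <= X + _]normsq1 normsq2.
  rewrite !mulr_sumr !rmorphXn; apply: lerD; apply: ler_sum => z _.
    exact: (adj_op_bound r1 b1 s1P).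
  exact: (adj_op_bound r2 b2 s2P).
rewrite E ler_pM2r ?lecR //; exact: normsq_gt0 fp0.
Qed.

End CartesianProduct.

(** * The height of a product *)

(** The triangle inequality in the plane for (sqrt a, sqrt b) and
(e / 2, e / 2), the latter vector having length at most e. *)
Lemma sqrtrD_perturb (F : rcfType) (a b e u v w : F) :
  0 <= a -> 0 <= b -> 0 < e -> 0 <= u -> 0 <= v ->
  u <= Num.sqrt a + e / 2 -> v <= Num.sqrt b + e / 2 ->
  w ^+ 2 <= u ^+ 2 + v ^+ 2 -> w <= Num.sqrt (a + b) + e.
Proof.
move=> a0 b0 e0 u0 v0 ua vb wuv.
have aE := sqr_sqrtr a0; have bE := sqr_sqrtr b0.
have abE := sqr_sqrtr (addr_ge0 a0 b0).
have sa := sqrtr_ge0 a; have sb := sqrtr_ge0 b; have sab := sqrtr_ge0 (a + b).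
have aab : Num.sqrt a <= Num.sqrt (a + b) by rewrite ler_wsqrtr // lerDl.
have bab : Num.sqrt b <= Num.sqrt (a + b) by rewrite ler_wsqrtr // lerDr.
have [w0|] := leP 0 w; last lra.
rewrite -ler_sqr ?nnegrE ?addr_ge0 ?(ltW e0) //.
have h1 : u ^+ 2 <= (Num.sqrt a + e / 2) ^+ 2.
  by rewrite ler_sqr ?nnegrE; lra.
have h2 : v ^+ 2 <= (Num.sqrt b + e / 2) ^+ 2.
  by rewrite ler_sqr ?nnegrE; lra.
have h3 : (Num.sqrt a + Num.sqrt b) * e <= (Num.sqrt (a + b) *+ 2) * e.
  by rewrite ler_pM2r //; lra.
have h4 := sqr_ge0 e.
by rewrite !sqrrD in h1 h2 *; lra.
Qed.

Lemma nu_cart_ge (R : realType) (G1 G2 : sgraph) (d1 d2 : nat) :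
  (0 < #|G1|)%N -> (0 < #|G2|)%N -> regular G1 d1 -> regular G2 d2 ->
  bipartite G1 -> bipartite G2 ->
  nu R G1 = d1%:R - Num.sqrt d1%:R -> nu R G2 = d2%:R - Num.sqrt d2%:R ->
  (d1 + d2)%:R - Num.sqrt (d1 + d2)%:R <= nu R (cart_prod G1 G2).
Proof.
move=> n1 n2 r1 r2 b1 b2 nu1 nu2; have [A AP] := b1.
have nG : (0 < #|cart_prod G1 G2|)%N by rewrite card_prod muln_gt0 n1.
(* The error e is shared equally between near-optimal potentials of the two
   factors. *)
apply/ler_addgt0Pr => /= e e0; have e2 : 0 < e / 2 by rewrite divr_gt0.
have [_ [s1 s1P <-] l1] := sup_adherent e2 (nu_has_sup R n1).
have [_ [s2 s2P <-] l2] := sup_adherent e2 (nu_has_sup R n2).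
rewrite -/(nu R G1) nu1 in l1; rewrite -/(nu R G2) nu2 in l2.
have lub : lambda1 (cart_potential A s1 s2) <= nu R (cart_prod G1 G2).
  apply: (sup_upper_bound (nu_has_sup R nG)).
  by exists (cart_potential A s1 s2) => //; exact: cart_potentialP.
apply: (le_trans _ (lerD lub (lexx e))).
have H := lambda1_cart_potential n1 n2 r1 r2 AP b2 s1P s2P.
have u1 := lambda1_le n1 r1 b1 s1P; have u2 := lambda1_le n2 r2 b2 s2P.
have s10 := sqrtr_ge0 (d1%:R : R); have s20 := sqrtr_ge0 (d2%:R : R).
have : (d1 + d2)%:R - lambda1 (cart_potential A s1 s2)
       <= Num.sqrt (d1 + d2)%:R + e.
  rewrite [X in Num.sqrt X]natrD.
  apply: (sqrtrD_perturb _ _ e0 _ _ _ _ H); rewrite ?ler0n //; lra.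
lra.
Qed.

Theorem proposition3p4 (R : realType) (G1 G2 : sgraph) (d1 d2 : nat)
    (G1_nonempty : (0 < #|G1|)%N) (G2_nonempty : (0 < #|G2|)%N)
    (G1_regular : regular G1 d1) (G2_regular : regular G2 d2)
    (G1_bipartite : bipartite G1) (G2_bipartite : bipartite G2)
    (nu1 : nu R G1 = d1%:R - Num.sqrt d1%:R)
    (nu2 : nu R G2 = d2%:R - Num.sqrt d2%:R) :
  regular (cart_prod G1 G2) (d1 + d2) /\
  bipartite (cart_prod G1 G2) /\
  nu R (cart_prod G1 G2) = (d1 + d2)%:R - Num.sqrt (d1 + d2)%:R.
Proof.
have Gr := cart_prod_regular G1_regular G2_regular.
have Gb := cart_prod_bipartite G1_bipartite G2_bipartite.
split=> //; split=> //; apply/eqP; rewrite eq_le nu_cart_ge // nu_le //.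
by rewrite card_prod muln_gt0 G1_nonempty.
Qed.
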